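(* Let $H$ be a separable infinite-dimensional complex Hilbert space, $J$ a conjugation in $H$, and $\mathcal F=\{f_k\}_{k\in\mathbb{Z}_+}$ an orthonormal basis in $H$ corresponding to $J$. Let $A$ be a J-symmetric (respectively, J-skew-symmetric) operator in $H$ with $\mathcal F\subset D(A)$, and let $a_{i,j}=(Af_j,f_i)$, $i,j\in\mathbb{Z}_+$. Define an operator $B$ on the domain $$D_B=\Big\{g=\sum_{k=0}^\infty g_kf_k\in H:\ \sum_{i=0}^\infty\Big|\sum_{k=0}^\infty a_{i,k}g_k\Big|^2<\infty\Big\}$$ by $$Bg=\sum_{i=0}^\infty y_if_i,\qquad y_i=\sum_{k=0}^\infty a_{i,k}g_k,\qquad g=\sum_{k=0}^\infty g_kf_k\in D_B .$$ Put $A^T:=JA^*J$. (1) If $A$ is closed and $\mathcal F$ is a basis of the matrix representation for $A$, then $A\subseteq A^T=B$ (respectively, $A\subseteq -A^T=B$). (2) Without the assumptions that $A$ is closed and that $\mathcal F$ is a basis of the matrix representation for $A$, one has $A\subseteq A^T\subseteq B$ (respectively, $A\subseteq -A^T\subseteq B$).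
   Context: $\mathbb{Z}_+$ is the set of non-negative integers. Linear operators $A$ in $H$ are possibly unbounded, defined on a linear subspace $D(A)\subseteq H$; $\subseteq$ between operators denotes extension. The scalar product $(\cdot,\cdot)$ is linear in the first argument. A conjugation in $H$ is a map $J:H\to H$ with $J^2=E$ (the identity) and $(Jx,Jy)=\overline{(x,y)}$ for all $x,y\in H$. An orthonormal basis $\{f_k\}_{k\in\mathbb{Z}_+}$ of $H$ corresponds to $J$ if $Jx=\sum_{k}\overline{x_k}f_k$ for every $x=\sum_kx_kf_k\in H$. The J-form is $[x,y]_J:=(x,Jy)$. A linear operator $A$ is J-symmetric if $[Ax,y]_J=[x,Ay]_J$ for all $x,y\in D(A)$, and J-skew-symmetric if $[Ax,y]_J=-[x,Ay]_J$ for all $x,y\in D(A)$. For a closed J-symmetric (or J-skew-symmetric) operator $A$ with $\mathcal F\subset D(A)$, let $T$ be the operator with domain the (algebraic) linear span of $\mathcal F$ acting by matrix multiplication by $(a_{i,j})$ (i.e. $Tf_j=\sum_ia_{i,j}f_i$); $T$ is closable. $\mathcal F$ is called a basis of the matrix representation for $A$ if $A=\overline{T}$, the closure of $T$. *)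

(* Defs.v *)
From HB Require Import structures.
From mathcomp Require Import all_boot all_order all_algebra.
From mathcomp Require Import all_classical all_reals all_analysis.
From mathcomp Require Import complex.

Set Implicit Arguments.
Unset Strict Implicit.
Unset Printing Implicit Defensive.

Import Order.TTheory GRing.Theory Num.Theory.
Import numFieldNormedType.Exports.

Local Open Scope classical_set_scope.
Local Open Scope complex_scope.
Local Open Scope ring_scope.

Definition separable_space (T : topologicalType) :=
  exists2 D : set T, countable D & dense D.

Definition infinite_dimensional (K : fieldType) (V : lmodType K) :=
  forall (n : nat) (v : 'I_n -> V),
    exists x, forall c : 'I_n -> K, x <> \sum_(i < n) c i *: v i.

(* A possibly unbounded operator; [papp] is meaningful only on [pdom].
   Linearity is the separate predicate [linear_operator]. *)
Record partial_op (V : Type) := PartialOp {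
  pdom : set V;
  papp :> V -> V
}.

Section Operators.
Context {R : realType} {H : completeNormedModType R[i]}.
Implicit Types (A B : partial_op H) (J : H -> H) (f : nat -> H).

Definition linear_operator A :=
  pdom A 0 /\
  forall (c : R[i]) (x y : H), pdom A x -> pdom A y ->
    pdom A (c *: x + y) /\ A (c *: x + y) = c *: A x + A y.

Definition graph A : set (H * H) := [set p | pdom A p.1 /\ p.2 = A p.1].

Definition op_sub A B := graph A `<=` graph B.

(* Equality as operators: values outside the domain are ignored. *)
Definition op_eq A B := graph A = graph B.

Definition closed_op A := closed (graph A).

Definition op_opp A := PartialOp (pdom A) (fun x => - A x).

Variable dot : {dot H for (@Num.conj R[i])}.

(* [{dot _ for _}] is only an inner product on the underlying vector space:
   the norm (and with it the topology, which is complete) has to be tied to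
   it. *)
Definition norm_from_dot := forall x : H, `|x| ^+ 2 = dot x x.

Definition conjugation J :=
  (forall x, J (J x) = x) /\ (forall x y, dot (J x) (J y) = (dot x y)^*%R).

Definition orthonormal_basis f :=
  (forall i j, dot (f i) (f j) = (i == j)%:R) /\
  (forall x, series (fun k => dot x (f k) *: f k) @ \oo --> x).

Definition corresponds f J :=
  forall x, series (fun k => (dot x (f k))^*%R *: f k) @ \oo --> J x.

Definition J_form J (x y : H) : R[i] := dot x (J y).

Definition J_symmetric J A :=
  forall x y, pdom A x -> pdom A y -> J_form J (A x) y = J_form J x (A y).

Definition J_skew_symmetric J A :=
  forall x y, pdom A x -> pdom A y -> J_form J (A x) y = - J_form J x (A y).

(* The value is the unique such [z] when [pdom A] is dense. *)
Definition adjoint A :=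
  let adj y := [set z | forall x, pdom A x -> dot (A x) y = dot x z] in
  PartialOp [set y | adj y !=set0] (fun y => xget 0 (adj y)).

(* A^T = J A^* J; a conjugation is everywhere defined, so only the domain of
   A^* restricts the composition. *)
Definition transpose_op J A :=
  PartialOp [set x | pdom (adjoint A) (J x)] (fun x => J (adjoint A (J x))).

Definition matrix_of f A (i j : nat) : R[i] := dot (A (f j)) (f i).

Section Matrix.
Variables (f : nat -> H) (a : nat -> nat -> R[i]).

(* The topology of the scalar field is found on [R[i]^o], not on [R[i]]. *)
Definition row_series (g : H) (i : nat) : (R[i]^o) ^nat :=
  series (fun k => a i k * dot g (f k)).

Definition matrix_coord (g : H) (i : nat) : R[i]^o := limn (row_series g i).

Definition matrix_act (g : H) : H :=
  limn (series (fun i => matrix_coord g i *: f i)).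

(* The convergence of each inner series, implicit in the condition
   \sum_i |\sum_k a_(i,k) g_k|^2 < oo, is made explicit since [limn] is
   total. *)
Definition matrix_op :=
  PartialOp [set g | (forall i, cvgn (row_series g i)) /\
                     cvgn (series (fun i => `|matrix_coord g i| ^+ 2))]
            matrix_act.

Definition basis_span : set H :=
  [set g | exists (n : nat) (c : nat -> R[i]), g = \sum_(k < n) c k *: f k].

(* For [g] in the span the inner sums of [matrix_act] are finite, so this is
   the linear operator with T f_j = \sum_i a_(i,j) f_i. *)
Definition span_op := PartialOp basis_span matrix_act.

End Matrix.

(* A is the closure of T: the graph of A is the closure of that of T. *)
Definition matrix_repr_basis f A :=
  graph A = closure (graph (span_op f (matrix_of f A))).

End Operators.

(* Main.v *)
Require Import Defs.
From HB Require Import structures.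
From mathcomp Require Import all_boot all_order all_algebra.
From mathcomp Require Import all_classical all_reals all_analysis.
From mathcomp Require Import complex ring.
Import Order.TTheory GRing.Theory Num.Theory.
Import numFieldNormedType.Exports.
Local Open Scope classical_set_scope.
Local Open Scope complex_scope.
Local Open Scope ring_scope.

(** Write e = 1 in the J-symmetric case and e = -1 in the J-skew-symmetric one,
    so that e^2 = 1 in both. The pairs (x, y) with
      (A u, J x) = e (u, J y)    for all u in D(A)
    form a relation [transpose_rel e]. Since D(A) contains a basis, A^* is
    determined by its defining identity, and conjugating that identity by J
    shows that this relation is the graph of e A^T ([graph_transpose],
    [graph_opp_transpose]). The symmetry assumption on A says precisely that
    the graph of A lies in [transpose_rel e], so A is contained in e A^T.

    As J fixes every f_k and (x, J y) is symmetric in x and y, the symmetry of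
    A becomes a_(i,k) = e a_(k,i) = e (A f_i, f_k). Hence for an arbitrary
    vector x the i-th row series is e times the expansion of (A f_i, J x) in
    the basis: it always converges, with sum e (A f_i, J x)
    ([row_series_cvg]). The value of the matrix on x is thus dictated by
    testing the identity above on u = f_i alone:
    - if (x, y) satisfies the identity for every u in D(A), then u = f_i gives
      that the i-th row sum is (y, f_i); these are square-summable by
      Parseval, so x is in D_B and B x = y ([transpose_sub_matrix]);
    - if x is in D_B and y = B x, then y has the row sums as coordinates by
      Riesz-Fischer, so the identity holds for u = f_i, hence on the linear
      span of the basis. For fixed (x, y) it is a closed condition on
      (u, A u), so it extends to all of D(A) as soon as A is the closure of
      its restriction to the span ([matrix_sub_transpose]). *)

(** * Inner products that induce the norm *)

Section InnerProduct.
Context {R : realType} {H : completeNormedModType R[i]}.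
Variable dot : {dot H for (@Num.conj R[i])}.

Lemma dotC (x y : H) : dot x y = (dot y x)^*%R.
Proof. by rewrite [LHS]hermC mul1r. Qed.

Lemma dotZr c (x y : H) : dot x (c *: y) = c^*%R * dot x y.
Proof. exact: linearZr_LR. Qed.

Lemma dotZl c (x y : H) : dot (c *: x) y = c * dot x y.
Proof. exact: linearZl_LR. Qed.

Lemma dotDl (x y z : H) : dot (x + y) z = dot x z + dot y z.
Proof. exact: linearDl. Qed.

Lemma dotBl (x y z : H) : dot (x - y) z = dot x z - dot y z.
Proof. exact: linearBl. Qed.

Lemma dotBr (x y z : H) : dot x (y - z) = dot x y - dot x z.
Proof. exact: linearBr. Qed.

Lemma dotNl (x y : H) : dot (- x) y = - dot x y.
Proof. exact: linearNl. Qed.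

Lemma dot_suml m n (u : nat -> H) y :
  dot (\sum_(m <= k < n) u k) y = \sum_(m <= k < n) dot (u k) y.
Proof. exact: linear_sumlz. Qed.

Hypothesis Hnorm : norm_from_dot dot.

(** The inequality ties the form to the topology of the space; every later
    limit inside the form goes through it. *)
Lemma cauchy_schwarz (x y : H) : `|dot x y| <= `|x| * `|y|.
Proof.
have [->|y0] := eqVneq y 0; first by rewrite linear0r !normr0 mulr0.
have yy : 0 < dot y y by rewrite dnorm_gt0.
rewrite -(@ler_pXn2r _ 2) ?nnegrE ?mulr_ge0 //.
rewrite exprMn !Hnorm -(ler_pM2l yy).
(* |(y,y) x - (x,y) y|^2 is (y,y) times the difference of the two sides. *)
have : 0 <= dot (dot y y *: x - dot x y *: y) (dot y y *: x - dot x y *: y).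
  exact: dnorm_ge0.
rewrite dotBl !dotBr !dotZl !dotZr (dotC y x) -(dotC y y) normCK.
set d := dot x y; set b := dot y y; set a := dot x x => h.
rewrite -subr_ge0; apply: le_trans h _.
rewrite le_eqVlt; apply/orP; left; apply/eqP; ring.
Qed.

Lemma cvg_dotl {T} {F : set_system T} {FF : Filter F} (u : T -> H) x y :
  u @ F --> x -> (fun t => dot (u t) y : R[i]^o) @ F --> (dot x y : R[i]^o).
Proof.
move=> ux; apply/cvgrPdist_lt => e e0.
(* The added 1 keeps the divisor positive when y = 0. *)
have y1 : 0 < `|y| + 1 by rewrite ltr_wpDl.
have : \forall t \near F, `|x - u t| < e / (`|y| + 1).
  by apply: cvgr_dist_lt => //; rewrite divr_gt0.
apply: filterS => t; rewrite ltr_pdivlMr // => xt.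
rewrite -dotBl; apply: le_lt_trans (cauchy_schwarz _ _) _.
apply: le_lt_trans xt.
by rewrite ler_wpM2l // lerDl.
Qed.

Lemma closed_dot_eq (c : R[i]) (x y : H) :
  closed [set p : H * H | dot p.2 x = c * dot p.1 y].
Proof.
rewrite (_ : mkset _ =
   (fun p : H * H => dot p.2 x - c * dot p.1 y : R[i]^o) @^-1` [set 0]).
  apply: preimage_closed; last first.
    by apply: accessible_closed_set1; apply: hausdorff_accessible;
      exact: norm_hausdorff.
  move=> p _; apply: cvgB; first by apply: cvg_dotl; exact: cvg_snd.
  by apply: cvgM; [exact: cvg_cst|apply: cvg_dotl; exact: cvg_fst].
apply/seteqP; split => p /=; first by move=> ->; rewrite subrr.
by move/eqP; rewrite subr_eq0 => /eqP.
Qed.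

(** * Orthonormal expansions *)

Variable f : nat -> H.
Hypothesis Hf : orthonormal_basis dot f.

Lemma eq_from_coords (x y : H) : (forall k, dot x (f k) = dot y (f k)) -> x = y.
Proof.
move=> xy; have [_ fx] := Hf.
rewrite -(cvg_lim (@norm_hausdorff _ H) (fx x)).
rewrite -(cvg_lim (@norm_hausdorff _ H) (fx y)).
by under eq_fun do rewrite xy.
Qed.

(** Continuity of the form lets it pass inside the expansion of x. *)
Lemma dot_series (x y : H) :
  series (fun k => dot x (f k) * dot (f k) y : R[i]^o) @ \oo -->
    (dot x y : R[i]^o).
Proof.
have [_ fx] := Hf.
rewrite (_ : series _ = fun n => dot (series (fun k => dot x (f k) *: f k) n) y).
  exact: (@cvg_dotl _ _ _ _ _ _ (fx x)).
apply/funext => n; rewrite /series /= dot_suml.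
by apply: eq_bigr => k _; rewrite dotZl.
Qed.

Lemma coord_sum (c : nat -> R[i]) m n j :
  dot (\sum_(m <= k < n) c k *: f k) (f j) = if (m <= j < n)%N then c j else 0.
Proof.
have [ff _] := Hf.
rewrite dot_suml -(big_nat1_eq +%R c) big_mkcond /=.
apply: eq_bigr => k _; rewrite dotZl ff.
by case: eqP => _; rewrite ?mulr1 ?mulr0.
Qed.

Lemma dnorm_sum (c : nat -> R[i]) m n :
  dot (\sum_(m <= k < n) c k *: f k) (\sum_(m <= k < n) c k *: f k)
  = \sum_(m <= k < n) `|c k| ^+ 2.
Proof.
rewrite dot_suml; apply: eq_big_nat => k mkn.
by rewrite dotZl (dotC (f k)) coord_sum mkn normCK.
Qed.

(** The partial sums are the squared norms of the partial sums of the expansion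
    of y, and those converge to y. *)
Lemma parseval (y : H) :
  series (fun i => `|dot y (f i)| ^+ 2) @ \oo --> dot y y.
Proof.
have [_ fx] := Hf.
rewrite (_ : series _ = fun n => `|series (fun k => dot y (f k) *: f k) n| ^+ 2).
  rewrite -Hnorm expr2; under eq_fun do rewrite expr2.
  by apply: cvgM; exact: (cvg_norm (fx y)).
by apply/funext => n; rewrite Hnorm dnorm_sum.
Qed.

(** By orthonormality, a segment of the vector series has squared norm equal
    to the same segment of the scalar series, so the Cauchy criterion carries
    over and completeness concludes. *)
Lemma riesz_fischer (c : nat -> R[i]^o) :
  cvgn (series (fun i => `|c i| ^+ 2)) -> cvgn (series (fun i => c i *: f i)).
Proof.
move=> /cvg_cauchy /(@cauchy_seriesP _ (R[i]^o)) cc.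
apply/cauchy_cvgP/cauchy_seriesP => e e0.
have := cc (e ^+ 2) (exprn_gt0 2 e0).
apply: filterS => -[m n] /= h.
rewrite -(@ltr_pXn2r _ 2) ?nnegrE ?(ltW e0) //.
rewrite Hnorm dnorm_sum; apply: le_lt_trans h.
by rewrite ger0_norm // sumr_ge0 // => k _; rewrite exprn_ge0.
Qed.

Lemma riesz_fischer_coord (c : nat -> R[i]^o) k :
  cvgn (series (fun i => `|c i| ^+ 2)) ->
  dot (limn (series (fun i => c i *: f i))) (f k) = c k.
Proof.
move=> /riesz_fischer /(@cvg_dotl _ _ _ _ _ (f k)) cy.
have Hd := @norm_hausdorff _ (R[i]^o).
rewrite -(cvg_lim Hd cy); apply: lim_near_cst => //.
(* The k-th coordinate of the partial sums is constant once n > k. *)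
near=> n; rewrite /series /= coord_sum.
by have -> : (k < n)%N by near: n; exact: nbhs_infty_gt.
Unshelve. all: by end_near.
Qed.

End InnerProduct.

(** * Operators and spans *)

Lemma graph_value {R : realType} {H : completeNormedModType R[i]}
    (A : partial_op H) u : pdom A u -> graph A (u, A u).
Proof. by []. Qed.

Lemma basis_span_ind {R : realType} {H : completeNormedModType R[i]}
    (f : nat -> H) (P : H -> Prop) :
  P 0 -> (forall k, P (f k)) ->
  (forall (c : R[i]) x y, P x -> P y -> P (c *: x + y)) ->
  forall u, basis_span f u -> P u.
Proof.
move=> P0 Pf Plin u [n [c ->]]; elim/big_ind : _ => // [x y Px Py|k _].
  by rewrite -[x]scale1r; exact: Plin.
by rewrite -[_ *: _]addr0; exact: Plin.
Qed.

(** * Conjugations and the transpose *)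

Section JForm.
Context {R : realType} {H : completeNormedModType R[i]}.
Variables (dot : {dot H for (@Num.conj R[i])}) (J : H -> H) (f : nat -> H).
Hypotheses (Hnorm : norm_from_dot dot) (HJ : conjugation dot J).

(** Both sides are the conjugate of (J x, y). *)
Lemma J_formC (x y : H) : dot x (J y) = dot y (J x).
Proof. by have [JK dotJ] := HJ; rewrite -{1}(JK x) dotJ -dotC. Qed.

Hypotheses (Hf : orthonormal_basis dot f) (HfJ : corresponds dot f J).

(** The coordinates of f_k are real, so conjugating them does not change its
    expansion. *)
Lemma conjugation_basis k : J (f k) = f k.
Proof.
have [ff fx] := Hf.
have Hd := @norm_hausdorff _ H.
rewrite -(cvg_lim Hd (HfJ (f k))) -[RHS](cvg_lim Hd (fx (f k))).
by under eq_fun do rewrite ff rmorph_nat -ff.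
Qed.

Variable A : partial_op H.
Hypotheses (HA : linear_operator A) (HfA : forall k, pdom A (f k)).

(** The graph of e A^T for e = 1 and e = -1. Being a condition on pairs, it
    treats both cases alike and avoids the choice of a value of A^*. *)
Definition transpose_rel (e : R[i]) : set (H * H) :=
  [set p | forall u, pdom A u -> dot (A u) (J p.1) = e * dot u (J p.2)].

(** The defining identity of A^* J x is the relation with J y in the place of
    the value; testing on the basis, which lies in D(A), makes that value
    unique. *)
Lemma graph_transpose : graph (transpose_op dot J A) = transpose_rel 1.
Proof.
have [JK _] := HJ.
apply/seteqP; split => -[x y] /=.
  move=> [/= /xgetPex adjx ->] u uA /=.
  by rewrite JK mul1r; exact: adjx.
move=> xy.
have ex : exists z, forall u, pdom A u -> dot (A u) (J x) = dot u z.
  by exists (J y) => u /xy; rewrite mul1r.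
split=> //=; rewrite -[LHS]JK; congr J.
apply: (eq_from_coords _ _ Hf) => k; rewrite ![dot _ (f k)]dotC; congr (_^*%R).
by have := xy _ (HfA k); rewrite /= mul1r => <-; exact: (xgetPex 0 ex).
Qed.

Lemma graph_opp_transpose :
  graph (op_opp (transpose_op dot J A)) = transpose_rel (- 1).
Proof.
have -> : graph (op_opp (transpose_op dot J A)) =
    [set p | graph (transpose_op dot J A) (p.1, - p.2)].
  apply/seteqP; split => -[x y] [/= xA yE]; split => //=.
    by rewrite yE opprK.
  by rewrite -yE opprK.
rewrite graph_transpose; apply/seteqP; split => -[x y] xy u uA;
  by rewrite (xy u uA) /= J_formC [in RHS]J_formC dotNl mul1r mulN1r.
Qed.

(** * The matrix operator against the transpose *)

Variable e : R[i].
Hypothesis ee : e * e = 1.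
(** For e = 1 this is J-symmetry, for e = -1 it is J-skew-symmetry. *)
Hypothesis Asym : graph A `<=` transpose_rel e.

Let a := matrix_of dot f A.

Lemma matrix_sym i k : a i k = e * a k i.
Proof.
rewrite /a /matrix_of -{1}(conjugation_basis i).
have /(_ _ (HfA k)) /= -> := Asym _ (graph_value A _ (HfA i)).
by rewrite J_formC conjugation_basis.
Qed.

(** By the symmetry of the matrix, a row of it is up to e the coordinate
    sequence of the vector A f_i, so the row series is an expansion of an
    inner product and converges for every x. *)
Lemma row_series_cvg (x : H) i :
  row_series dot f a x i @ \oo --> (e * dot (A (f i)) (J x) : R[i]^o).
Proof.
rewrite (_ : row_series _ _ _ _ _ =
    fun n => e * series (fun k => dot (A (f i)) (f k) * dot (f k) (J x)) n).
  by apply: cvgM; [exact: cvg_cst|exact: dot_series].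
apply/funext => n; rewrite /row_series /series /= mulr_sumr.
apply: eq_bigr => k _.
by rewrite matrix_sym mulrA (J_formC (f k)) conjugation_basis.
Qed.

Lemma matrix_coordE (x : H) i :
  matrix_coord dot f a x i = e * dot (A (f i)) (J x).
Proof. by apply: cvg_lim (row_series_cvg x i); exact: norm_hausdorff. Qed.

(** Testing the relation on u = f_i identifies the row sums with the
    coordinates of y. *)
Lemma transpose_sub_matrix : transpose_rel e `<=` graph (matrix_op dot f a).
Proof.
move=> [x y] xy.
have coord i : matrix_coord dot f a x i = dot y (f i).
  rewrite matrix_coordE (xy _ (HfA i)) /= mulrA ee mul1r.
  by rewrite J_formC conjugation_basis.
split; first split => /=.
- by move=> i; apply: cvgP (row_series_cvg x i).
- under eq_fun do rewrite coord.
  exact: cvgP (parseval _ Hnorm _ Hf y).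
- rewrite /= /matrix_act; under eq_fun do rewrite coord.
  have [_ fy] := Hf.
  by apply/esym; apply: cvg_lim (fy y); exact: norm_hausdorff.
Qed.

(** The matrix acts on the span as A does, because A is itself contained in
    the matrix operator by [transpose_sub_matrix]. *)
Lemma span_op_sub : graph (span_op dot f a) `<=` graph A.
Proof.
move=> [u v] /= [/= uf ->].
have uA : pdom A u.
  have [A0 Alin] := HA.
  apply: (basis_span_ind f _ A0 HfA _ _ uf) => c w z wA zA.
  by have [] := Alin c w z wA zA.
split=> //=.
by have [_ /= ->] := transpose_sub_matrix _ (Asym _ (graph_value A _ uA)).
Qed.

(** The relation has to be verified for every u in D(A). It holds for the
    basis vectors because the row sums are the coordinates of y, then on the
    span by linearity, and it survives the closure of the graph. *)
Lemma matrix_sub_transpose : matrix_repr_basis dot f A ->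
  graph (matrix_op dot f a) `<=` transpose_rel e.
Proof.
move=> AT [x y] [[/= rows sq] yE].
have yi i : dot y (f i) = matrix_coord dot f a x i.
  by rewrite yE; exact: (riesz_fischer_coord _ Hnorm _ Hf).
have onbasis k : dot (A (f k)) (J x) = e * dot (f k) (J y).
  by rewrite (J_formC (f k)) conjugation_basis yi matrix_coordE mulrA ee mul1r.
have onspan u : basis_span f u ->
    pdom A u /\ dot (A u) (J x) = e * dot u (J y).
  move=> uf; have [A0 Alin] := HA.
  apply: (basis_span_ind f (fun u => pdom A u /\ _) _ _ _ _ uf).
  (* A 0 = 0, by applying linearity to -0 + 0. *)
  - split=> //; have [_] := Alin (- 1) 0 0 A0 A0.
    rewrite !scaleN1r !addNr => ->.
    by rewrite !linear0l mulr0.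
  - by move=> k; split.
  - move=> c w z [wA wE] [zA zE]; have [wzA ->] := Alin c w z wA zA.
    split=> //; rewrite !dotDl !dotZl wE zE; ring.
move=> u uA.
have := graph_value A _ uA.
pose C := [set p : H * H | dot p.2 (J x) = e * dot p.1 (J y)].
rewrite AT => /(@closureS _ _ C).
have /closure_id <- := closed_dot_eq _ Hnorm e (J x) (J y).
apply=> -[w z] /[dup] /span_op_sub [_ /= ->] [/= wf _].
by have [] := onspan w wf.
Qed.

End JForm.

Theorem theorem3p3 (R : realType) (H : completeNormedModType R[i])
    (dot : {dot H for (@Num.conj R[i])}) (J : H -> H) (f : nat -> H)
    (A : partial_op H)
    (Hnorm : norm_from_dot dot)
    (Hsep : separable_space H)
    (Hinf : infinite_dimensional H)
    (HJ : conjugation dot J)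
    (Hf : orthonormal_basis dot f)
    (HfJ : corresponds dot f J)
    (HA : linear_operator A)
    (HfA : forall k, pdom A (f k)) :
  let AT := transpose_op dot J A in
  let B := matrix_op dot f (matrix_of dot f A) in
  (J_symmetric dot J A ->
     (closed_op A -> matrix_repr_basis dot f A -> op_sub A AT /\ op_eq AT B) /\
     (op_sub A AT /\ op_sub AT B)) /\
  (J_skew_symmetric dot J A ->
     (closed_op A -> matrix_repr_basis dot f A ->
        op_sub A (op_opp AT) /\ op_eq (op_opp AT) B) /\
     (op_sub A (op_opp AT) /\ op_sub (op_opp AT) B)).
Proof.
move=> AT B.
have both e : e * e = 1 -> graph A `<=` transpose_rel dot J A e ->
    (matrix_repr_basis dot f A -> transpose_rel dot J A e = graph B) /\
    transpose_rel dot J A e `<=` graph B.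
  move=> ee Asym.
  have le : transpose_rel dot J A e `<=` graph B.
    exact: transpose_sub_matrix.
  split=> // AT_basis; apply/seteqP; split=> //.
  exact: matrix_sub_transpose.
split=> Asym; rewrite /op_sub /op_eq.
- have AAT : graph A `<=` transpose_rel dot J A 1.
    by move=> [x y] [/= xA ->] u uA; rewrite mul1r; exact: Asym.
  rewrite /AT (graph_transpose _ _ _ HJ Hf) //.
  by have [eqB leB] := both 1 (mulr1 1) AAT; split=> // _ /eqB.
- have AAT : graph A `<=` transpose_rel dot J A (- 1).
    by move=> [x y] [/= xA ->] u uA; rewrite mulN1r; exact: Asym.
  rewrite /AT (graph_opp_transpose _ _ _ HJ Hf) //.
  have NN : (- 1) * (- 1) = 1 :> R[i] by rewrite mulrNN mulr1.
  by have [eqB leB] := both (- 1) NN AAT; split=> // _ /eqB.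
Qed.
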